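(* Let $R$ be a principal ideal domain and let $(G,A)$ be an arbitrary edge-labeled connected graph with $n$ vertices and edge labels in $R$. Suppose that $\mathcal{B}=\{B_1,\dots,B_n\}$ is a flow-up class basis for the module $R_G$ of generalized splines. For each $i$, let $l_i$ be the leading term of $B_i$, and define $Q=l_1\cdots l_n$. Then $\mathcal{C}=\{C_1,\dots,C_n\}\subset R_G$ is a basis for $R_G$ if and only if $\det[C_1,\dots,C_n]=uQ$ for some unit $u\in R$.
   Context: Graphs are finite, and each edge joins two distinct vertices. For a connected graph $G$ with ordered vertices $v_1,\dots,v_n$, edges $e_1,\dots,e_m$ and edge labels $A=\{a_1,\dots,a_m\}\subseteq R$ ($a_k$ being the label of $e_k$), a generalized spline on $G$ over $R$ is a tuple $(f_1,\dots,f_n)\in R^n$ such that whenever $v_i$ and $v_j$ are joined by the edge $e_k$, $f_i-f_j\in\langle a_k\rangle$. The set $R_G$ of all generalized splines is an $R$-submodule of $R^n$. For $0\le i<n$, the $i$th flow-up class $\mathcal{F}_i$ is the set of splines $F=(0,\dots,0,f_{i+1},\dots,f_n)\in R_G$ with exactly $i$ leading zeros, i.e. $f_1=\dots=f_i=0$ and $f_{i+1}\neq0$. A flow-up class basis with $n$ elements is a module basis of $R_G$ consisting of one element from each of $\mathcal{F}_0,\dots,\mathcal{F}_{n-1}$. The leading term of a nonzero spline is its first nonzero entry. $[C_1,\dots,C_n]$ denotes the $n\times n$ matrix whose columns are $C_1,\dots,C_n$. *)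

(* Defs.v *)
From HB Require Import structures.
From mathcomp Require Import all_boot all_order all_algebra all_fingroup.

Set Implicit Arguments.
Unset Strict Implicit.
Unset Printing Implicit Defensive.

Import GRing.Theory.
Local Open Scope ring_scope.

(* Ideals are Prop-valued predicates: a boolean predicate would only range
   over the decidable ideals of R. *)
Record is_ideal (R : comNzRingType) (I : R -> Prop) : Prop := IsIdeal {
  ideal0 : I 0;
  idealD : forall x y : R, I x -> I y -> I (x + y);
  idealM : forall r x : R, I x -> I (r * x) }.

Definition principal_ideal (R : comNzRingType) (a x : R) : Prop :=
  exists r : R, x = r * a.

Definition is_PID (R : idomainType) : Prop :=
  forall I : R -> Prop, is_ideal I ->
    exists a : R, forall x : R, I x <-> principal_ideal a x.

(* Parallel edges are allowed, loops are not; labels may be arbitrary,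
   including zero. *)
Record edge_labeled_graph (R : Type) (n : nat) := EdgeLabeledGraph {
  nedges : nat;
  edge_ends : 'I_nedges -> {set 'I_n};
  card_edge_ends : forall k : 'I_nedges, #|edge_ends k| = 2%N;
  edge_label : 'I_nedges -> R }.

Definition adjacent (R : Type) (n : nat) (G : edge_labeled_graph R n) :
    rel 'I_n :=
  fun i j => [exists k : 'I_(nedges G), edge_ends k == [set i; j]].

Definition connected_graph (R : Type) (n : nat) (G : edge_labeled_graph R n) :
    Prop :=
  (0 < n)%N /\ forall i j : 'I_n, connect (adjacent G) i j.

(* Elements of R^n are column vectors; f i 0 is the entry of f at vertex i. *)
Definition is_spline (R : comNzRingType) (n : nat)
    (G : edge_labeled_graph R n) (f : 'cV[R]_n) : Prop :=
  forall (k : 'I_(nedges G)) (i j : 'I_n), edge_ends k = [set i; j] ->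
    principal_ideal (edge_label k) (f i 0 - f j 0).

Lemma is_spline_submod (R : comNzRingType) (n : nat)
    (G : edge_labeled_graph R n) :
  is_spline G 0 /\
  forall (c : R) (f g : 'cV[R]_n),
    is_spline G f -> is_spline G g -> is_spline G (c *: f + g).
Proof.
split=> [k i j _|c f g Hf Hg k i j Hk].
  by exists 0; rewrite !mxE subrr mul0r.
have [r Hr] := Hf _ _ _ Hk; have [s Hs] := Hg _ _ _ Hk.
exists (c * r + s).
by rewrite !mxE mulrDl -mulrA -Hr -Hs mulrBr opprD addrACA.
Qed.

Record is_basis (R : comNzRingType) (V : lmodType R) (M : V -> Prop)
    (m : nat) (B : 'I_m -> V) : Prop := IsBasis {
  basis_mem : forall i : 'I_m, M (B i);
  basis_free : forall c : 'I_m -> R,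
    \sum_(i < m) c i *: B i = 0 -> forall i : 'I_m, c i = 0;
  basis_span : forall v : V, M v ->
    exists c : 'I_m -> R, v = \sum_(i < m) c i *: B i }.

(* The entries indexed by 0, ..., i - 1 are the i leading ones. *)
Definition flow_up_class (R : comNzRingType) (n : nat)
    (G : edge_labeled_graph R n) (i : 'I_n) (f : 'cV[R]_n) : Prop :=
  [/\ is_spline G f, forall j : 'I_n, (j < i)%N -> f j 0 = 0 & f i 0 <> 0].

(* The order in which the basis elements are listed is not tied to the order
   of the flow-up classes, whence the permutation s. *)
Definition is_flow_up_basis (R : comNzRingType) (n : nat)
    (G : edge_labeled_graph R n) (B : 'I_n -> 'cV[R]_n) : Prop :=
  is_basis (is_spline G) B /\
  exists s : 'S_n, forall i : 'I_n, flow_up_class G i (B (s i)).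

(* First nonzero entry, with default value 0 on the zero vector. *)
Definition leading_term (R : comNzRingType) (n : nat) (f : 'cV[R]_n) : R :=
  head 0 [seq f i 0 | i <- enum 'I_n & f i 0 != 0].

Definition col_matrix (R : comNzRingType) (n : nat) (C : 'I_n -> 'cV[R]_n) :
    'M[R]_n :=
  \matrix_(i, j) C j i 0.

(* Main.v *)
Require Import Defs.
From HB Require Import structures.
From mathcomp Require Import all_boot all_order all_algebra all_fingroup.

Set Implicit Arguments.
Unset Strict Implicit.
Unset Printing Implicit Defensive.

Import GRing.Theory.
Local Open Scope ring_scope.

(** Expanding each [C j] in the basis [B] gives a factorization
    [[C_1, ..., C_n] = [B_1, ..., B_n] *m P], hence [det C = det B * det P].
    When [det B] is nonzero, it can be cancelled from determinant identities
    over the domain [R]. If [C] is also a basis, the reverse expansion of [B]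
    in [C] shows that [det P] is a unit; conversely, if [det C] is a unit
    multiple of [det B], then [P] is invertible, so [C] spans what [B] spans,
    and [C] is free because its determinant is nonzero
    ([is_basis_det_associate]).

    For a flow-up basis, listing the vectors in the order of their flow-up
    classes makes the matrix lower triangular with the leading terms on the
    diagonal. So [det B] is, up to the sign of the reordering, the nonzero
    product of the leading terms ([det_flow_up_basis]), and the sign is
    absorbed by the unit. *)

Lemma sum_col_matrix (R : comNzRingType) (n : nat) (B : 'I_n -> 'cV[R]_n)
    (c : 'I_n -> R) :
  \sum_(i < n) c i *: B i = col_matrix B *m \col_i c i.
Proof.
apply/matrixP=> i k; rewrite ord1 summxE !mxE; apply: eq_bigr => j _.
by rewrite !mxE mulrC.
Qed.

Lemma col_matrix_factor (R : comNzRingType) (n : nat) (M : 'cV[R]_n -> Prop)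
    (B C : 'I_n -> 'cV[R]_n) :
  is_basis M B -> (forall i, M (C i)) ->
  exists P : 'M[R]_n, col_matrix C = col_matrix B *m P.
Proof.
move=> basisB MC.
have [p Cp] := fin_all_exists (fun j => basis_span basisB (MC j)).
exists (\matrix_(i, j) p j i); apply/matrixP=> i j.
rewrite [LHS]mxE Cp sum_col_matrix !mxE.
by apply: eq_bigr => k _; rewrite !mxE.
Qed.

(** Multiplying a linear relation by the adjugate turns it into
    [det C *: c = 0]. *)
Lemma free_of_det_neq0 (R : idomainType) (n : nat) (C : 'I_n -> 'cV[R]_n) :
  \det (col_matrix C) != 0 ->
  forall c : 'I_n -> R,
    \sum_(i < n) c i *: C i = 0 -> forall i : 'I_n, c i = 0.
Proof.
move=> detC c; rewrite sum_col_matrix => Cc0 i.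
have /matrixP/(_ i 0) : \det (col_matrix C) *: \col_i c i = 0 :> 'cV[R]_n.
  by rewrite -mul_scalar_mx -mul_adj_mx -mulmxA Cc0 mulmx0.
by rewrite !mxE => /eqP; rewrite mulf_eq0 (negPf detC) => /eqP.
Qed.

(** If both are bases, the two change-of-basis determinants are inverse to each
    other once [det B] is cancelled. If [det C] is a unit multiple of [det B],
    the transition matrix [P] has unit determinant, and its inverse turns
    coordinates in [B] into coordinates in [C]. *)
Lemma is_basis_det_associate (R : idomainType) (n : nat)
    (M : 'cV[R]_n -> Prop) (B C : 'I_n -> 'cV[R]_n) :
  is_basis M B -> \det (col_matrix B) != 0 -> (forall i, M (C i)) ->
  is_basis M C <->
  exists2 u : R, u \is a GRing.unit
    & \det (col_matrix C) = u * \det (col_matrix B).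
Proof.
move=> basisB detB MC.
have [P CBP] := col_matrix_factor basisB MC.
have detC : \det (col_matrix C) = \det P * \det (col_matrix B).
  by rewrite CBP det_mulmx mulrC.
split=> [basisC | [u Uu detCu]].
  exists (\det P) => //.
  have [P' BCP'] := col_matrix_factor basisC (Defs.basis_mem basisB).
  apply/unitrPr; exists (\det P'); apply: (mulIf detB).
  by rewrite mul1r {2}BCP' det_mulmx detC mulrAC.
have unitP : P \in unitmx.
  by rewrite unitmxE (mulIf detB (etrans (esym detC) detCu)).
split=> // [|v Mv].
  apply: free_of_det_neq0; rewrite detCu mulf_neq0 //.
  by apply: contraTneq Uu => ->; rewrite unitr0.
have [c ->] := basis_span basisB Mv.
exists (fun i => (invmx P *m \col_i c i) i 0); rewrite !sum_col_matrix CBP.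
have -> : \col_i (invmx P *m \col_i c i) i 0 = invmx P *m \col_i c i.
  by apply/matrixP=> i j; rewrite ord1 mxE.
by rewrite -mulmxA mulKVmx.
Qed.

Lemma leading_term_flow_up (R : comNzRingType) (n : nat)
    (G : edge_labeled_graph R n) (i : 'I_n) (f : 'cV[R]_n) :
  flow_up_class G i f -> leading_term f = f i 0.
Proof.
case=> _ f0 /eqP fi; rewrite /leading_term.
(* The enumeration of the vertices splits at [i], and the filter discards the
   whole initial segment. *)
have iE : i = nth i (enum 'I_n) i by rewrite nth_ord_enum.
rewrite -(cat_take_drop i (enum 'I_n)) (drop_nth i) ?size_enum_ord // -iE.
rewrite filter_cat /= fi.
suff -> : [seq j <- take i (enum 'I_n) | f j 0 != 0] = [::] by [].
apply/eqP; rewrite -(negbK (_ == _)) -has_filter.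
apply/hasPn => j /(map_f val); rewrite map_take val_enum_ord take_iota mem_iota.
by case/andP=> _; rewrite add0n leq_min => /andP[ltji _]; rewrite negbK f0.
Qed.

(** Permuting the columns by [s] makes the matrix lower triangular, since
    column [i] then has [i] leading zeros and its leading term on the
    diagonal; the sign is the cost of that permutation. *)
Lemma det_flow_up_basis (R : comNzRingType) (n : nat)
    (G : edge_labeled_graph R n) (B : 'I_n -> 'cV[R]_n) (s : 'S_n) :
  (forall i : 'I_n, flow_up_class G i (B (s i))) ->
  \prod_(i < n) leading_term (B i) = (-1) ^+ s * \det (col_matrix B).
Proof.
move=> flowB.
have -> : (-1) ^+ s * \det (col_matrix B) = \det (col_perm s (col_matrix B)).
  by rewrite col_permE det_mulmx det_perm odd_permV mulrC.
rewrite det_trig; last first.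
  by apply/is_trig_mxP=> i j ltij; rewrite !mxE; have [_ B0 _] := flowB j; apply: B0.
rewrite (reindex_inj (@perm_inj _ s)); apply: eq_bigr => i _.
by rewrite (leading_term_flow_up (flowB i)) !mxE.
Qed.

Theorem corollary4p3 (R : idomainType) (R_PID : is_PID R) (n : nat)
    (G : edge_labeled_graph R n) (G_connected : connected_graph G)
    (B : 'I_n -> 'cV[R]_n) (B_basis : is_flow_up_basis G B)
    (C : 'I_n -> 'cV[R]_n) (C_spline : forall i : 'I_n, is_spline G (C i)) :
  let Q := \prod_(i < n) leading_term (B i) in
  is_basis (is_spline G) C <->
  exists2 u : R, u \is a GRing.unit & \det (col_matrix C) = u * Q.
Proof.
move=> Q; have [basisB [s flowB]] := B_basis.
have QE : Q = (-1) ^+ s * \det (col_matrix B) := det_flow_up_basis flowB.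
have Q_neq0 : Q != 0.
  rewrite /Q (reindex_inj (@perm_inj _ s)); apply/prodf_neq0 => i _.
  by rewrite (leading_term_flow_up (flowB i)); case: (flowB i) => _ _ /eqP.
have detB : \det (col_matrix B) != 0.
  by apply: contraNneq Q_neq0 => detB0; rewrite QE detB0 mulr0.
have unit_sign : (-1) ^+ s \is a @GRing.unit R by rewrite unitrX ?unitrN1.
have [basis_det det_basis] := is_basis_det_associate basisB detB C_spline.
split=> [/basis_det[u Uu ->] | [u Uu detC]].
  exists (u * (-1) ^+ s); first by rewrite unitrM Uu.
  by rewrite QE -mulrA signrMK.
by apply: det_basis; exists (u * (-1) ^+ s); rewrite ?unitrM ?Uu // detC QE mulrA.
Qed.
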